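(* Let $(M,g,K)$ be a statistical manifold. Define a commutative product on the tangent spaces of $M$ by $X\circ Y=K(X,Y)$ (equivalently, $\partial_i\circ\partial_j=K(\partial_i,\partial_j)$ for coordinate vector fields $\partial_i=\partial/\partial x^i$, extended bilinearly). Then $\circ$ is associative if and only if $M$ has zero sectional $K$-curvature. The assertion holds pointwise: for each $p\in M$, the product $\circ$ on $T_pM$ is associative if and only if $k(\pi)=0$ for every plane $\pi\subset T_pM$.
   Context: A statistical manifold $(M,g,K)$ is a Riemannian manifold $(M,g)$ together with a smooth $(1,2)$-tensor field $K$ such that $g(K(X,Y),Z)$ is symmetric in $X,Y,Z$. Write $K_XY=K(X,Y)$. The $(1,3)$-tensor $[K,K]$ is defined by $[K,K](X,Y)Z=[K_X,K_Y]Z=K_XK_YZ-K_YK_XZ$. For a plane ($2$-dimensional subspace) $\pi\subset T_pM$, the sectional $K$-curvature is $k(\pi)=g([K,K](e_1,e_2)e_2,e_1)$, where $e_1,e_2$ is an orthonormal basis of $\pi$; this does not depend on the choice of orthonormal basis. *)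

(* Defs.v *)
From HB Require Import structures.
From mathcomp Require Import all_boot all_order all_algebra.
From mathcomp Require Import sesquilinear.
From mathcomp Require Import all_classical all_reals all_analysis.
From mathcomp Require Import ring.

Set Implicit Arguments.
Unset Strict Implicit.
Unset Printing Implicit Defensive.

Import Order.TTheory GRing.Theory Num.Theory.
Import numFieldNormedType.Exports.

Local Open Scope classical_set_scope.
Local Open Scope ring_scope.

(* Iterated directional derivatives up to order [k] exist and are continuous
   on [U]; meant for open [U] in a finite-dimensional space. *)
Fixpoint Ck (R : realType) (V W : normedModType R) (k : nat) (U : set V)
    (f : V -> W) : Prop :=
  (forall x, U x -> {for x, continuous f}) /\
  (if k is k'.+1 then
     forall v, (forall x, U x -> derivable f x v) /\
               Ck k' U (fun x => 'D_v f x)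
   else True).

Definition smooth_on (R : realType) (V W : normedModType R) (U : set V)
    (f : V -> W) : Prop := forall k, Ck k U f.

Section CkTheory.
Context {R : realType} {V : normedModType R}.
Implicit Types (U : set V) (k : nat).

Lemma Ck_ext (W : normedModType R) k U (f g : V -> W) : open U ->
  (forall x, U x -> f x = g x) -> Ck k U f -> Ck k U g.
Proof.
move=> oU; elim: k f g => [|k IH] f g fg;
  (have nfg x : U x -> {near x, f =1 g} by
    move=> Ux; apply: filterS (open_nbhs_nbhs (conj oU Ux)) => y /fg);
  (have cfg : (forall x, U x -> {for x, continuous f}) ->
              forall x, U x -> {for x, continuous g} by
    move=> cf x Ux; rewrite /prop_for /continuous_at -(fg _ Ux);
    apply: cvg_trans (cf _ Ux); apply: near_eq_cvg; exact: nfg).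
  by move=> [cf _]; split => //; exact: cfg.
move=> [cf Df]; split; first exact: cfg.
move=> v; have [df Dfk] := Df v; split.
  by move=> x Ux; apply: near_eq_derivable (df _ Ux); exact: nfg.
by apply: IH Dfk => x Ux; apply: near_eq_derive; exact: nfg.
Qed.

Lemma CkW (W : normedModType R) k U (f : V -> W) : Ck k.+1 U f -> Ck k U f.
Proof.
elim: k f => [|k IH] f [cf Df]; split => // v.
by have [df /IH] := Df v.
Qed.

Lemma Ck_cst (W : normedModType R) k U (a : W) : Ck k U (cst a).
Proof.
elim: k a => [|k IH] a; (split; first by move=> x _; exact: cst_continuous) => //.
move=> v; split; first by move=> x _; exact: derivable_cst.
have -> : (fun x => 'D_v (cst a) x) = cst 0 :> (V -> W).
  by apply/funext => x; exact: derive_cst.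
exact: IH.
Qed.

Lemma CkD (W : normedModType R) k U (f g : V -> W) :
  open U -> Ck k U f -> Ck k U g -> Ck k U (f + g).
Proof.
move=> oU; elim: k f g => [|k IH] f g [cf Df] [cg Dg];
  (split; first by move=> x Ux; exact: (cvgD (cf _ Ux) (cg _ Ux))) => //.
move=> v; have [df Dfk] := Df v; have [dg Dgk] := Dg v; split.
  by move=> x Ux; exact: (derivableD (df _ Ux) (dg _ Ux)).
apply: Ck_ext (IH _ _ Dfk Dgk) => // x Ux.
by rewrite (deriveD (df _ Ux) (dg _ Ux)).
Qed.

Lemma CkM k U (f g : V -> R^o) :
  open U -> Ck k U f -> Ck k U g -> Ck k U (f \* g : V -> R^o).
Proof.
move=> oU; elim: k f g => [|k IH] f g Cf Cg;
  have [cf Df] := Cf; have [cg Dg] := Cg;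
  (split; first by move=> x Ux; exact: (cvgM (cf _ Ux) (cg _ Ux))) => //.
move=> v; have [df Dfk] := Df v; have [dg Dgk] := Dg v; split.
  by move=> x Ux; exact: (derivableM (df _ Ux) (dg _ Ux)).
apply: Ck_ext (CkD oU (IH _ _ (CkW Cf) Dgk) (IH _ _ (CkW Cg) Dfk)) => // x Ux.
by rewrite (deriveM (df _ Ux) (dg _ Ux)).
Qed.

End CkTheory.

Record chart (R : realType) (n : nat) (M : topologicalType) := Chart {
  chart_dom : set M ;
  chart_map : M -> 'rV[R]_n ;
  chart_inv : 'rV[R]_n -> M ;
  chart_dom_open : open chart_dom ;
  chart_codom_open : open (chart_map @` chart_dom) ;
  chart_mapK : forall x, chart_dom x -> chart_inv (chart_map x) = x ;
  chart_map_continuous : {within chart_dom, continuous chart_map} ;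
  chart_inv_continuous : {within chart_map @` chart_dom, continuous chart_inv}
}.

Arguments chart_dom_open {R n M} c.
Arguments chart_codom_open {R n M} c.

Definition smooth_compatible (R : realType) (n : nat) (M : topologicalType)
    (a b : chart R n M) : Prop :=
  smooth_on (chart_map a @` (chart_dom a `&` chart_dom b))
            (chart_map b \o chart_inv a).

HB.mixin Record Topological_isSmoothManifold (R : realType) (n : nat)
    (M : Type) of Topological M := {
  atlas : set (chart R n M) ;
  atlas_cover : forall p : M, exists2 c, atlas c & chart_dom c p ;
  atlas_compatible : forall a b, atlas a -> atlas b -> smooth_compatible a b ;
  manifold_hausdorff : hausdorff_space M ;
  manifold_second_countable : @second_countable M
}.

#[short(type="smoothManifoldType")]
HB.structure Definition SmoothManifold (R : realType) (n : nat) :=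
  {M of Topological M & Topological_isSmoothManifold R n M}.

Section SmoothFunctions.
Context {R : realType} {n : nat} (M : smoothManifoldType R n).

Definition smooth_function (f : M -> R^o) : Prop :=
  forall c : chart R n M, atlas c ->
    smooth_on (chart_map c @` chart_dom c) (f \o chart_inv c).

Definition smooth_pred : {pred M -> R^o} :=
  [pred f : M -> R^o | `[< smooth_function f >]].

Lemma smooth_predP f : reflect (smooth_function f) (f \in smooth_pred).
Proof. by rewrite inE; exact: asboolP. Qed.

Lemma smooth_cst (a : R) : smooth_function (cst a).
Proof. by move=> c _ k; exact: Ck_cst. Qed.

Lemma smoothD f g :
  smooth_function f -> smooth_function g -> smooth_function (f + g).
Proof.
move=> sf sg c ac k.
have H := CkD (chart_codom_open c) (sf c ac k) (sg c ac k); exact: H.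
Qed.

Lemma smoothM f g :
  smooth_function f -> smooth_function g -> smooth_function (f * g).
Proof.
move=> sf sg c ac k.
have H := CkM (chart_codom_open c) (sf c ac k) (sg c ac k); exact: H.
Qed.

Lemma smoothZ (a : R) f : smooth_function f -> smooth_function (a *: f).
Proof. by move=> sf; exact: smoothM (smooth_cst a) sf. Qed.

Lemma smoothN f : smooth_function f -> smooth_function (- f).
Proof. by move=> sf; rewrite -scaleN1r; exact: smoothZ. Qed.

Lemma smooth_subring_closed : subring_closed smooth_pred.
Proof.
split; first exact/smooth_predP/smooth_cst.
  by move=> f g /smooth_predP sf /smooth_predP sg;
     apply/smooth_predP/smoothD => //; exact: smoothN.
by move=> f g /smooth_predP sf /smooth_predP sg; exact/smooth_predP/smoothM.
Qed.

Lemma smooth_submod_closed : submod_closed smooth_pred.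
Proof.
split; first exact/smooth_predP/smooth_cst.
move=> a f g /smooth_predP sf /smooth_predP sg.
by apply/smooth_predP/smoothD => //; exact: smoothZ.
Qed.

Record Cinfty := SmoothFun {
  smooth_val :> M -> R^o ;
  _ : smooth_val \in smooth_pred
}.

HB.instance Definition _ := [isSub for smooth_val].
HB.instance Definition _ := [Choice of Cinfty by <:].
HB.instance Definition _ := GRing.SubChoice_isSubComPzRing.Build
  (M -> R^o) smooth_pred Cinfty smooth_subring_closed.
HB.instance Definition _ := GRing.SubZmodule_isSubLmodule.Build
  R (M -> R^o) smooth_pred Cinfty smooth_submod_closed.

End SmoothFunctions.

Section TangentSpace.
Context {R : realType} {n : nat} {M : smoothManifoldType R n}.

(* Tangent vectors at [p] are the derivations of C^oo(M) at [p]. *)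
Definition derivation_at (p : M) (v : Cinfty M -> R^o) : Prop :=
  linear v /\ forall f g : Cinfty M, v (f * g) = f p * v g + g p * v f.

Definition derivation_pred (p : M) : {pred Cinfty M -> R^o} :=
  [pred v : Cinfty M -> R^o | `[< derivation_at p v >]].

Lemma derivation_predP p v :
  reflect (derivation_at p v) (v \in derivation_pred p).
Proof. by rewrite inE; exact: asboolP. Qed.

Lemma derivation_submod_closed p : submod_closed (derivation_pred p).
Proof.
split.
  apply/derivation_predP; split=> [a f g|f g].
    by rewrite /= scaler0 addr0.
  by rewrite /= !mulr0 addr0.
move=> a v w /derivation_predP[lv Lv] /derivation_predP[lw Lw].
apply/derivation_predP; split=> [b f g|f g].
  rewrite -[LHS]/(a * v (b *: f + g) + w (b *: f + g)) lv lw.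
  rewrite -[RHS]/(b * (a * v f + w f) + (a * v g + w g)).
  by rewrite -[b *: v f]/(b * v f) -[b *: w f]/(b * w f); ring.
rewrite -[LHS]/(a * v (f * g) + w (f * g)) Lv Lw.
rewrite -[RHS]/(f p * (a * v g + w g) + g p * (a * v f + w f)).
by ring.
Qed.

Record tangent (p : M) := TangentVector {
  tangent_val :> Cinfty M -> R^o ;
  _ : tangent_val \in derivation_pred p
}.

HB.instance Definition _ p := [isSub for @tangent_val p].
HB.instance Definition _ p := [Choice of tangent p by <:].
HB.instance Definition _ p := GRing.SubChoice_isSubLmodule.Build
  R (Cinfty M -> R^o) (derivation_pred p) (tangent p)
  (derivation_submod_closed p).

Definition smooth_field (X : forall p : M, tangent p) : Prop :=
  forall f : Cinfty M, smooth_function (fun p => X p f).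

End TangentSpace.

Section StatisticalStructure.
Context {R : realType} {n : nat}.

(* Tensor fields are smooth when they send smooth vector fields to smooth
   functions, resp. smooth vector fields. *)
Record riemannian_metric (M : smoothManifoldType R n) := RiemannianMetric {
  metric_at :> forall p : M, {dot (tangent p) for idfun} ;
  metric_smooth : forall X Y : forall p : M, tangent p,
    smooth_field X -> smooth_field Y ->
    smooth_function (fun p => metric_at p (X p) (Y p))
}.

Record tensor12_field (M : smoothManifoldType R n) := Tensor12Field {
  tensor12_at :> forall p : M,
    {bilinear (tangent p) -> (tangent p) -> (tangent p)} ;
  tensor12_smooth : forall X Y : forall p : M, tangent p,
    smooth_field X -> smooth_field Y ->
    smooth_field (fun p => tensor12_at p (X p) (Y p))
}.

(* The two transpositions generate all permutations of [X, Y, Z]. *)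
Record statistical_structure (M : smoothManifoldType R n) :=
    StatisticalStructure {
  metric : riemannian_metric M ;
  difference_tensor : tensor12_field M ;
  cubic_sym12 : forall (p : M) (X Y Z : tangent p),
    metric p (difference_tensor p X Y) Z = metric p (difference_tensor p Y X) Z ;
  cubic_sym23 : forall (p : M) (X Y Z : tangent p),
    metric p (difference_tensor p X Y) Z = metric p (difference_tensor p X Z) Y
}.

End StatisticalStructure.

Section SectionalKCurvature.
Context {R : realType} {n : nat} {M : smoothManifoldType R n}.
Variables (S : statistical_structure M) (p : M).
Implicit Types (X Y Z u v : tangent p) (P : set (tangent p)).

Local Notation g := (metric S p).
Local Notation K := (difference_tensor S p).

Definition statistical_product X Y : tangent p := K X Y.

Definition K_bracket X Y Z : tangent p := K X (K Y Z) - K Y (K X Z).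

Definition span2 u v : set (tangent p) :=
  [set w | exists a b : R, w = a *: u + b *: v].

Definition lin_indep2 u v : Prop :=
  forall a b : R, a *: u + b *: v = 0 -> a = 0 /\ b = 0.

Definition is_plane P : Prop :=
  exists u v, lin_indep2 u v /\ P = span2 u v.

Definition orthonormal_basis P : set (tangent p * tangent p) :=
  [set e | [/\ g e.1 e.1 = 1, g e.2 e.2 = 1, g e.1 e.2 = 0
             & P = span2 e.1 e.2]].

(* Independent of the basis picked by [xget], see [sectional_K_curvatureE]. *)
Definition sectional_K_curvature P : R :=
  let e := xget (0, 0) (orthonormal_basis P) in
  g (K_bracket e.1 e.2 e.2) e.1.

Lemma metricC u v : g u v = g v u.
Proof. by rewrite hermitian_subproof expr0 mul1r. Qed.

Lemma metric_inj u v : (forall w, g u w = g v w) -> u = v.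
Proof.
move=> uv; apply/eqP; rewrite -subr_eq0; apply/negPn/negP => /neq0_dnorm_gt0.
by move=> /(_ _ g); rewrite linearBl /= uv subrr ltxx.
Qed.

Lemma statistical_productC : commutative statistical_product.
Proof. by move=> X Y; apply: metric_inj => Z; exact: cubic_sym12. Qed.

Lemma K_bracketE X Y Z W :
  g (K_bracket X Y Z) W = g (K X W) (K Y Z) - g (K Y W) (K X Z).
Proof.
by rewrite /K_bracket linearBl cubic_sym23 [g (K Y _) _]cubic_sym23.
Qed.

Lemma metric_combl (a b : R) u v w :
  g (a *: u + b *: v) w = a * g u w + b * g v w.
Proof. by rewrite linearDl /= !linearZl_LR. Qed.

Lemma metric_combr (a b : R) u v w :
  g w (a *: u + b *: v) = a * g w u + b * g w v.
Proof. by rewrite metricC metric_combl ![g _ w]metricC. Qed.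

Lemma difference_tensor_combl (a b : R) u v w :
  K (a *: u + b *: v) w = a *: K u w + b *: K v w.
Proof. by rewrite linearDl /= !linearZl_LR. Qed.

Lemma difference_tensor_combr (a b : R) u v w :
  K w (a *: u + b *: v) = a *: K w u + b *: K w v.
Proof. by rewrite linearDr /= !linearZr_LR. Qed.

Lemma K_bracket_span2 (a b c d : R) u v :
  g (K_bracket (a *: u + b *: v) (c *: u + d *: v) (c *: u + d *: v))
    (a *: u + b *: v)
  = (a * d - b * c) ^+ 2 * g (K_bracket u v v) u.
Proof.
rewrite !K_bracketE !difference_tensor_combl !difference_tensor_combr.
have -> : K v u = K u v by exact: statistical_productC.
rewrite !(metric_combl, metric_combr).
rewrite [g (K v v) (K u u)]metricC [g (K u v) (K u u)]metricC.
by rewrite [g (K v v) (K u v)]metricC; ring.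
Qed.

Lemma span2S u v u' v' :
  span2 u v u' -> span2 u v v' -> span2 u' v' `<=` span2 u v.
Proof.
move=> [a [b ->]] [c [d ->]] _ [x [y ->]].
exists (x * a + y * c), (x * b + y * d).
by rewrite !scalerDr !scalerDl !scalerA addrACA.
Qed.

Lemma is_plane_orthonormal_basis P :
  is_plane P -> orthonormal_basis P !=set0.
Proof.
move=> [u [v [uv ->]]].
have gt0 w : w != 0 -> 0 < g w w by move=> ?; exact: neq0_dnorm_gt0.
have unit w : w != 0 -> (Num.sqrt (g w w))^-1 ^+ 2 * g w w = 1.
  move=> /gt0 w0; rewrite exprVn sqr_sqrtr ?ltW // mulVf //.
  by rewrite gt_eqF.
have sq w : w != 0 -> Num.sqrt (g w w) != 0.
  by move=> /gt0 w0; rewrite gt_eqF // sqrtr_gt0.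
have gZ (a : R) w w' : g (a *: w) w' = a * g w w' by rewrite linearZl_LR.
have gZr (a : R) w w' : g w (a *: w') = a * g w w' by rewrite linearZr_LR.
have u0 : u != 0.
  apply/eqP => u0; have [] := uv 1 0; first by rewrite u0 scaler0 scale0r addr0.
  by move/eqP; rewrite oner_eq0.
set a := (Num.sqrt (g u u))^-1; pose e1 := a *: u.
have a0 : a != 0 by rewrite invr_eq0 sq.
have e11 : g e1 e1 = 1 by rewrite gZ gZr mulrA -expr2 unit.
pose b := g v e1; pose w := v - b *: e1.
have w0 : w != 0.
  apply/eqP => w0; have [] := uv (- (b * a)) 1.
    by rewrite scaleNr scale1r addrC -scalerA.
  by move=> _ /eqP; rewrite oner_eq0.
have we1 : g w e1 = 0 by rewrite linearBl /= gZ e11 mulr1 subrr.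
set c := (Num.sqrt (g w w))^-1; pose e2 := c *: w.
have c0 : c != 0 by rewrite invr_eq0 sq.
exists (e1, e2); split => /=.
- exact: e11.
- by rewrite gZ gZr mulrA -expr2 unit.
- by rewrite gZr metricC we1 mulr0.
apply/seteqP; split; apply: span2S.
- exists a^-1, 0.
  by rewrite scale0r addr0 scalerA mulVf // scale1r.
- exists b, c^-1.
  by rewrite [c^-1 *: _]scalerA mulVf // scale1r addrC subrK.
- by exists a, 0; rewrite scale0r addr0.
- exists (- (c * b * a)), c.
  by rewrite /e2 /w scalerBr /e1 !scalerA scaleNr addrC.
Qed.

Lemma sectional_K_curvatureE P e : orthonormal_basis P e ->
  sectional_K_curvature P = g (K_bracket e.1 e.2 e.2) e.1.
Proof.
move=> onb; rewrite /sectional_K_curvature.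
case: xgetP => [[u v] _ /= [/= uu vv uv sP]|/(_ e)//].
case: e onb => e1 e2 /= [/= e11 e22 e12 eP].
have : P u by rewrite sP; exists 1, 0; rewrite scale1r scale0r addr0.
have : P v by rewrite sP; exists 0, 1; rewrite scale1r scale0r add0r.
rewrite eP => -[c [d vE]] [a [b uE]].
have gE (x y z t : R) :
    g (x *: e1 + y *: e2) (z *: e1 + t *: e2) = x * z + y * t.
  rewrite metric_combl !metric_combr.
  by rewrite [g e2 e1]metricC e11 e22 e12; ring.
move: uu vv uv; rewrite uE vE !gE K_bracket_span2 => uu vv uv.
suff -> : (a * d - b * c) ^+ 2 = 1 by rewrite mul1r.
transitivity ((a * a + b * b) * (c * c + d * d) - (a * c + b * d) ^+ 2).
  by ring.
by rewrite uu vv uv; ring.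
Qed.

End SectionalKCurvature.

Arguments statistical_product {R n M} S p X Y.
Arguments K_bracket {R n M} S {p} X Y Z.
Arguments is_plane {R n M p} P.
Arguments orthonormal_basis {R n M} S {p} P.
Arguments sectional_K_curvature {R n M} S {p} P.

(* Main.v *)
Require Import Defs.
From mathcomp Require Import all_boot all_order all_algebra.
From mathcomp Require Import all_classical all_reals all_analysis.
From mathcomp Require Import ring lra.

(** Since [K] is symmetric, associativity at [p] says that the operators [K X]
    commute, that is, [[K, K] = 0] ([associative_K_bracketP]).  So the theorem
    is that the curvature-like tensor [[K, K]] is determined by its sectional
    values.  Total symmetry of [g (K X Y) Z] turns
    [g ([K, K](X, Y) Z) W] into [g (K X W) (K Y Z) - g (K Y W) (K X Z)], a
    difference of two values of the form
    [F (X W | Y Z) = g (K X W) (K Y Z)], which depends only on the partition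
    of four vectors into two unordered pairs.  Vanishing sectional curvature
    means [F (u u | v v) = F (u v | u v)]
    ([K_bracket_eq0_of_sectional]); polarizing it in [u] and then in [v]
    shows that the value of [F] on each of the three pairings of four vectors
    is the mean of the two others, hence that the three agree
    ([metric_K_exchange]).  The global assertion is the pointwise one
    quantified over [p]. *)

Import GRing.Theory Num.Theory.

Local Open Scope classical_set_scope.
Local Open Scope ring_scope.

Section Pointwise.
Context {R : realType} {n : nat} {M : smoothManifoldType R n}.
Variables (S : statistical_structure M) (p : M).
Implicit Types (u v w z X Y Z : tangent p).

Local Notation g := (metric S p).
Local Notation K := (difference_tensor S p).

Lemma difference_tensorC X Y : K X Y = K Y X.
Proof. exact: statistical_productC. Qed.

Lemma associative_K_bracketP :
  associative (statistical_product S p) <->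
  (forall X Y Z, K_bracket S X Y Z = 0).
Proof.
rewrite /associative /statistical_product /K_bracket.
split=> [KA X Y Z | K0 X Y Z].
  by rewrite !KA [K Y X]difference_tensorC subrr.
move/eqP: (K0 X Z Y); rewrite subr_eq0 => /eqP KE.
by rewrite [K Y Z]difference_tensorC KE difference_tensorC.
Qed.

(** The quantity [g ([K, K](u, v) v) u] scales by the squared determinant
    under a change of [(u, v)].  A nontrivial relation [a u + b v = 0] would
    thus force it to vanish, while for independent [u, v] it is a multiple of
    the sectional curvature of their plane. *)
Lemma K_bracket_eq0_of_sectional u v :
  (forall P : set (tangent p), is_plane P -> sectional_K_curvature S P = 0) ->
  g (K_bracket S u v v) u = 0.
Proof.
move=> k0; apply/eqP/negPn/negP => Q0.
have uv_indep : lin_indep2 u v.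
  move=> a b ab0.
  have bracket0m X Y : g (K_bracket S X 0 0) Y = 0.
    by rewrite K_bracketE !linear0r subrr.
  have det0 (c d : R) : c = d -> 0 = c ^+ 2 * g (K_bracket S u v v) u -> d = 0.
    move=> <- /esym/eqP; rewrite mulf_eq0 (negPf Q0) orbF sqrf_eq0.
    by move/eqP.
  (* Replacing u, resp. v, by the combination has determinant a, resp. b. *)
  split.
    have := K_bracket_span2 S a b 0 1 u v; rewrite ab0 linear0r.
    by apply: det0; ring.
  have := K_bracket_span2 S 1 0 a b u v; rewrite ab0 bracket0m.
  by apply: det0; ring.
have plane : is_plane (span2 u v) by exists u, v.
have [e onb] := is_plane_orthonormal_basis S plane.
have k_e : g (K_bracket S e.1 e.2 e.2) e.1 = 0.
  by rewrite -(sectional_K_curvatureE onb); exact: k0.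
have [_ _ _ uvE] := onb.
have : span2 u v u by exists 1, 0; rewrite scale1r scale0r addr0.
have : span2 u v v by exists 0, 1; rewrite scale1r scale0r add0r.
rewrite uvE => -[c [d vE]] [a [b uE]].
by move: Q0; rewrite uE vE K_bracket_span2 k_e mulr0 eqxx.
Qed.

(** By symmetry of [K], the hypothesis reads [g (K u u) (K v v) = g (K u v) (K u v)];
    this is its full polarization. *)
Lemma metric_K_exchange :
  (forall u v, g (K_bracket S u v v) u = 0) ->
  forall u w v z, g (K u w) (K v z) = g (K u v) (K w z).
Proof.
move=> Q0.
have Q u v : g (K u u) (K v v) = g (K u v) (K u v).
  move/eqP: (Q0 u v).
  by rewrite K_bracketE [K v u]difference_tensorC subr_eq0 => /eqP.
have polar1 u w v : g (K u w) (K v v) = g (K u v) (K w v).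
  have := Q (u + w) v.
  rewrite !(linearDl, linearDr) /= !Q.
  rewrite [K w u]difference_tensorC [g (K w v) (K u v)]metricC.
  by move=> ?; lra.
have polar2 u w v z :
    2 * g (K u w) (K v z) = g (K u v) (K w z) + g (K u z) (K w v).
  have := polar1 u w (v + z).
  rewrite !(linearDl, linearDr) /= !polar1 [K z v]difference_tensorC.
  by move=> ?; lra.
move=> u w v z.
have := polar2 u w v z; have := polar2 u v w z.
by rewrite [K v w]difference_tensorC => ? ?; lra.
Qed.

Lemma associative_sectionalP :
  associative (statistical_product S p) <->
  (forall P : set (tangent p), is_plane P -> sectional_K_curvature S P = 0).
Proof.
rewrite associative_K_bracketP; split=> [K0 P planeP | k0 X Y Z].
  have [e onb] := is_plane_orthonormal_basis S planeP.
  by rewrite (sectional_K_curvatureE onb) K0 linear0l.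
apply: (@metric_inj _ _ _ S) => W; rewrite linear0l K_bracketE.
rewrite [K X W]difference_tensorC [K Y W]difference_tensorC.
rewrite metric_K_exchange ?subrr // => u v.
exact: K_bracket_eq0_of_sectional.
Qed.

End Pointwise.

Theorem proposition3p4 (R : realType) (n : nat) (M : smoothManifoldType R n)
    (S : statistical_structure M) :
  ((forall p : M, associative (statistical_product S p)) <->
   (forall (p : M) (P : set (tangent p)),
      is_plane P -> sectional_K_curvature S P = 0))
  /\
  (forall p : M,
     associative (statistical_product S p) <->
     (forall P : set (tangent p),
        is_plane P -> sectional_K_curvature S P = 0)).
Proof.
split; last by move=> p; exact: associative_sectionalP.
by split=> H p; apply/associative_sectionalP; exact: H.
Qed.
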